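(* Let $n \geq 1$. Any complex polynomial $$f(z) = z^n + a_{n-1}z^{n-1} + \cdots + a_1 z + a_0$$ can be written in the form $$f(z) = \frac{1}{n} \sum_{i=1}^n (z-z_i)^n,$$ where the complex numbers $z_1, \ldots, z_n$ are uniquely determined up to their order. Moreover, if $M = \max_{1 \leq j \leq n} |c_j|^{1/j}$, where $c_j = \dfrac{n\, a_{n-j}}{\binom{n}{j}}$ for $1 \leq j \leq n$, then $|z_i| \leq C_n M$ for all $1 \leq i \leq n$, where $$C_n = \frac{1}{\sin \frac{\pi}{2n}}.$$ *)

(* Defs.v *)
From mathcomp Require Import all_boot all_order all_algebra.
From mathcomp Require Import all_reals all_analysis.
From mathcomp Require Export complex.
Import ComplexField.

Set Implicit Arguments.
Unset Strict Implicit.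
Unset Printing Implicit Defensive.

Import GRing.Theory Num.Theory.
Local Open Scope ring_scope.

Definition power_mean (R : realType) (n : nat) (z : n.-tuple R[i]) :
    {poly R[i]} :=
  n%:R^-1 *: \sum_(i < n) ('X - (tnth z i)%:P) ^+ n.

(* Meant for f monic of degree n and 1 <= j <= n. *)
Definition ncoef (R : realType) (n : nat) (f : {poly R[i]}) (j : nat) : R[i] :=
  n%:R * f`_(n - j) / 'C(n, j)%:R.

(* The norm of R[i] as a numFieldType is R[i]-valued; normc is the same modulus
   with values in R. The neutral element 0 of the maximum is harmless, as all
   the terms are nonnegative. *)
Definition coef_bound (R : realType) (n : nat) (f : {poly R[i]}) : R :=
  \big[Num.max/0]_(1 <= j < n.+1) (Normc.normc (ncoef n f j) `^ j%:R^-1).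

Definition sin_const (R : realType) (n : nat) : R :=
  (sin (pi / (2 * n)%:R))^-1.

(* Main.v *)
(* Comparing coefficients, f = power_mean z says that the power sums of z are
   p_j = (-1)^j c_j for 1 <= j <= n. By Newton's identities the first n power
   sums determine, and can be prescribed through, the polynomial prod (X - z_i),
   which gives existence and uniqueness. Moreover |p_j| <= M^j propagates through
   the identities to |e_k| <= M^k for the elementary symmetric functions, so all
   z_i lie in the disc of radius 2 M, and 2 <= 1 / sin (pi / (2 n)) once 3 <= n.
   For n = 2 the constant is sqrt 2, and the bound follows from the parallelogram
   inequality applied to 2 z_1 = (z_1 + z_2) + (z_1 - z_2). *)

Require Import Defs.
From mathcomp Require Import all_boot all_order all_algebra.
From mathcomp Require Import all_reals all_analysis.
From mathcomp Require Import ring lra.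
Import ComplexField.
Import Order.TTheory GRing.Theory Num.Theory.

Local Open Scope ring_scope.

(** * Power sums, elementary symmetric functions and Newton's identities *)

Definition psum {F : nzRingType} (s : seq F) (k : nat) : F :=
  \sum_(x <- s) x ^+ k.

(** The reciprocal polynomial of the product of the ['X - x%:P]: its coefficient of index k is
    (-1)^k e_k, whatever the size of [s]. *)
Definition revprod {F : comNzRingType} (s : seq F) : {poly F} :=
  \prod_(x <- s) (1 - x *: 'X).

(* Newton's identity, for b k = (-1)^k e_k. *)
Definition newton_rel {F : nzRingType} (b p : nat -> F) (k : nat) : Prop :=
  b k.+1 *+ k.+1 = - \sum_(j < k.+1) b j * p (k - j).+1.

Lemma coef0_revprod {F : comNzRingType} (s : seq F) : (revprod s)`_0 = 1.
Proof.
rewrite /revprod -horner_coef0 horner_prod big1 // => x _.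
by rewrite !hornerE ?mulr0 subr0.
Qed.

Lemma revprod_cons {F : comNzRingType} (x : F) (s : seq F) :
  revprod (x :: s) = (1 - x *: 'X) * revprod s.
Proof. by rewrite /revprod big_cons. Qed.

(** A geometric series with its remainder: modulo ['X^m], the sum is [x] times the inverse of
    [1 - x *: 'X]. *)
Lemma geom_poly_mul {F : comNzRingType} (x : F) (m : nat) :
  (1 - x *: 'X) * \poly_(k < m) x ^+ k.+1 = x%:P - (x ^+ m.+1) *: 'X^m.
Proof.
elim: m => [|m IHm].
  by rewrite poly_def big_ord0 mulr0 expr1 expr0 alg_polyC subrr.
move: IHm; rewrite !poly_def big_ord_recr mulrDr /= => ->.
rewrite mulrBl mul1r -scalerAl -scalerAr -exprS scalerA -exprS.
by rewrite addrA subrK.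
Qed.

(* The logarithmic derivative of [prod (1 - x X)] is
   [- sum_k psum s k.+1 X^k], here truncated modulo [X^m]. *)
Lemma deriv_revprod {F : comNzRingType} (s : seq F) (m : nat) :
  exists T, (revprod s)^`() =
    - (revprod s * \poly_(k < m) psum s k.+1) + 'X^m * T.
Proof.
elim: s => [|x s [T IHs]].
  exists 0; rewrite /revprod big_nil derivC mulr0 addr0 mul1r.
  by apply/polyP => i; rewrite coefN coef_poly /psum big_nil !coef0 if_same oppr0.
(* The first term is inherited from [s]; the second is the remainder of the geometric series of the
   new factor. *)
exists ((1 - x *: 'X) * T - (x ^+ m.+1) *: revprod s).
have -> : \poly_(k < m) psum (x :: s) k.+1 =
    \poly_(k < m) x ^+ k.+1 + \poly_(k < m) psum s k.+1.
  apply/polyP => i; rewrite coefD !coef_poly /psum big_cons.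
  by case: ifP; rewrite ?addr0.
rewrite revprod_cons derivM derivB derivC derivZ derivX sub0r IHs.
have := geom_poly_mul x m.
rewrite alg_polyC -[(x ^+ m.+1) *: _]mul_polyC -[(x ^+ m.+1) *: _]mul_polyC => E.
transitivity (- ((1 - x *: 'X) * \poly_(k < m) x ^+ k.+1) * revprod s
  - (1 - x *: 'X) * revprod s * \poly_(k < m) psum s k.+1
  + (1 - x *: 'X) * ('X^m * T) - (x ^+ m.+1)%:P * 'X^m * revprod s).
  by rewrite E; ring.
by ring.
Qed.

(** Compare the coefficients of ['X^k] in the logarithmic derivative; truncation at ['X^k.+1] leaves
    them free of the error term. *)
Lemma newton_revprod {F : comNzRingType} (s : seq F) (k : nat) :
  newton_rel (fun i => (revprod s)`_i) (psum s) k.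
Proof.
have [T] := deriv_revprod s k.+1.
move=> /(congr1 (fun p : {poly F} => p`_k)).
rewrite coef_deriv coefD coefN coefXnM ltnSn addr0 coefM => E.
rewrite /newton_rel E; congr (- _).
by apply: eq_bigr => j _; rewrite coef_poly ltnS leq_subr.
Qed.

Lemma size_revprod {F : comNzRingType} (s : seq F) :
  (size (revprod s) <= (size s).+1)%N.
Proof.
elim: s => [|x s IHs]; first by rewrite /revprod big_nil size_poly1.
rewrite revprod_cons (leq_trans (size_polyMleq _ _))//.
have h : (size (1 - x *: 'X : {poly F})%R <= 2)%N.
  rewrite (leq_trans (size_polyD _ _))// geq_max size_poly1 /= size_polyN.
  by rewrite (leq_trans (size_scale_leq _ _))// size_polyX.
by rewrite -subn1 leq_subLR add1n; apply: leq_add h IHs.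
Qed.

Lemma coef_prod_XsubC {F : comNzRingType} (s : seq F) (i k : nat) :
  (i + k)%N = size s -> (\prod_(x <- s) ('X - x%:P))`_i = (revprod s)`_k.
Proof.
elim: s i k => [|x s IHs] i k.
  by case: i k => [|?] [|?] //= _; rewrite /revprod !big_nil.
rewrite revprod_cons big_cons /= => ik.
rewrite !mulrBl mul1r -scalerAl !coefB coefZ coefXM coefCM coefXM.
(* At the two ends, [i = 0] or [k = 0], one coefficient in the recursion lies beyond the degree of
   its polynomial and vanishes. *)
case: i k ik => [|i] [|k] //=.
- rewrite add0n => -[ks]; rewrite (IHs 0 k)//.
  by rewrite [(revprod s)`_k.+1]nth_default // ks size_revprod.
- rewrite addn0 => -[ik]; rewrite (IHs i 0) ?addn0//; congr (_ - _ * _).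
  by rewrite nth_default// ik size_prod_XsubC.
- rewrite addSn => -[ik]; rewrite (IHs i k.+1)// (IHs i.+1 k)//.
  by rewrite addSn -addnS.
Qed.

(** * Newton's recursion between arbitrary sequences *)

Lemma newton_coef_uniq {F : numDomainType} (b b' p p' : nat -> F) (n : nat) :
  b 0%N = b' 0%N -> (forall k, (k < n)%N -> p k.+1 = p' k.+1) ->
  (forall k, (k < n)%N -> newton_rel b p k) ->
  (forall k, (k < n)%N -> newton_rel b' p' k) ->
  forall k, (k <= n)%N -> b k = b' k.
Proof.
move=> b0 pp' nb nb'; elim/ltn_ind => -[//|k] IHk kn.
(* Characteristic zero: [k.+1] cancels, so the earlier terms determine [b k.+1]. *)
apply: (pmulrnI (ltn0Sn k)); rewrite nb// nb'//; congr (- _).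
apply: eq_bigr => j _; rewrite IHk ?pp'//; last by rewrite (leq_trans (ltnW _) kn).
by rewrite (leq_ltn_trans (leq_subr _ _)).
Qed.

(** In the relation of index [k], [p k.+1] occurs only with the coefficient [b 0 = 1], so the
    recursion can be solved for it without division. *)
Lemma newton_psum_uniq {F : nzRingType} (b b' p p' : nat -> F) (n : nat) :
  b 0%N = 1 -> (forall k, (k <= n)%N -> b k = b' k) ->
  (forall k, (k < n)%N -> newton_rel b p k) ->
  (forall k, (k < n)%N -> newton_rel b' p' k) ->
  forall k, (k < n)%N -> p k.+1 = p' k.+1.
Proof.
move=> b0 bb' nb nb'; elim/ltn_ind => k IHk kn.
have := nb k kn; rewrite /newton_rel bb'// nb'// => /oppr_inj/esym.
rewrite 2!big_ord_recl -bb'// b0 !mul1r subn0.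
rewrite (eq_bigr (fun i : 'I_k => b' (lift ord0 i) * p' (k - lift ord0 i).+1)).
  by move/addIr.
move=> i _; rewrite bb'; last by rewrite lift0 (leq_trans (ltn_ord i) (ltnW kn)).
have ik : (k - lift ord0 i < k)%N.
  by rewrite lift0 ltn_subrL /= (leq_ltn_trans (leq0n _) (ltn_ord i)).
by rewrite IHk// (ltn_trans ik).
Qed.

Lemma newton_coef_exists {F : numFieldType} (p : nat -> F) (n : nat) :
  exists b : nat -> F,
    b 0%N = 1 /\ forall k, (k < n)%N -> newton_rel b p k.
Proof.
elim: n => [|n [b [b0 nb]]]; first by exists (fun=> 1).
(* The value that the relation of index [n] forces on [b n.+1]. *)
pose c := - (\sum_(j < n.+1) b j * p (n - j).+1) / n.+1%:R.
exists (fun k => if (k <= n)%N then b k else c); split=> [//|k].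
rewrite /newton_rel ltnS leq_eqVlt => /predU1P[->|kn].
  rewrite ltnn -mulr_natr divfK ?pnatr_eq0//; congr (- _).
  by apply: eq_bigr => j _; rewrite -ltnS ltn_ord.
rewrite kn nb//; congr (- _); apply: eq_bigr => j _.
by rewrite (leq_trans _ (ltnW kn))// -ltnS.
Qed.

(** Each of the [k.+1] products in the recursion is at most [M ^+ k.+1] in norm, and the factor
    [k.+1] on the left absorbs their number. *)
Lemma newton_norm_le {F : numDomainType} (b p : nat -> F) (M : F) (n : nat) :
  b 0%N = 1 -> (forall k, (k < n)%N -> `|p k.+1| <= M ^+ k.+1) ->
  (forall k, (k < n)%N -> newton_rel b p k) ->
  forall k, (k <= n)%N -> `|b k| <= M ^+ k.
Proof.
move=> b0 pM nb; elim/ltn_ind => -[_ _|k IHk kn]; first by rewrite b0 normr1.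
rewrite -(@ler_pMn2r _ k.+1)// -normrMn nb// normrN.
rewrite (le_trans (ler_norm_sum _ _ _))//.
rewrite -[leRHS](_ : \sum_(j < k.+1) M ^+ k.+1 = _); last first.
  by rewrite sumr_const card_ord.
apply: ler_sum => j _; rewrite normrM.
have jk : (j <= k)%N by rewrite -ltnS.
have -> : M ^+ k.+1 = M ^+ j * M ^+ (k - j).+1 by rewrite -exprD addnS subnKC.
rewrite ler_pM ?normr_ge0 ?IHk ?pM//.
- by rewrite (leq_trans jk (ltnW kn)).
- by rewrite (leq_ltn_trans (leq_subr _ _)).
Qed.

(** * Multisets with prescribed power sums *)

Lemma psum_exists {F : numClosedFieldType} (p : nat -> F) (n : nat) :
  exists2 s : seq F, size s = n & forall k, (k < n)%N -> psum s k.+1 = p k.+1.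
Proof.
have [b [b0 nb]] := newton_coef_exists p n.
(* The roots of [P] will be the points: with [b] in reverse order, [P] is monic and [revprod] of its
   roots has the coefficients [b]. *)
pose P := \poly_(i < n.+1) b (n - i)%N.
have lP : P`_n = 1 by rewrite coef_poly ltnSn subnn.
have sP : size P = n.+1 by rewrite size_poly_eq// subnn b0 oner_eq0.
have [s] := closed_field_poly_normal P.
rewrite lead_coefE sP lP scale1r => Ps.
have ss : size s = n by move: sP; rewrite Ps size_prod_XsubC => -[].
exists s => // k kn; symmetry.
apply: (newton_psum_uniq b (fun i => (revprod s)`_i) p (psum s) n) => // [i ile|? _].
  rewrite -(coef_prod_XsubC s (n - i)%N) ?ss ?subnK// -Ps coef_poly.
  by rewrite ltnS leq_subr subKn.
exact: newton_revprod.
Qed.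

Lemma perm_eq_psum {F : numFieldType} (s t : seq F) :
  size s = size t ->
  (forall k, (k < size s)%N -> psum s k.+1 = psum t k.+1) -> perm_eq s t.
Proof.
move=> st pst; apply/prod_XsubC_eq/polyP => i.
have [iles|] := leqP i (size s).
  rewrite !(coef_prod_XsubC _ i (size s - i)) ?subnKC -?st//.
  apply: (newton_coef_uniq (fun i => (revprod s)`_i) (fun i => (revprod t)`_i)
    (psum s) (psum t) (size s)); rewrite ?coef0_revprod ?leq_subr//.
  - by move=> *; apply: newton_revprod.
  - by move=> *; apply: newton_revprod.
by move=> si; rewrite !nth_default// size_prod_XsubC -?st.
Qed.

(** * Moduli of points with bounded power sums *)

Lemma norm_root_le {F : numClosedFieldType} (s : seq F) (M : F) :
  0 <= M -> (forall k, (k < size s)%N -> `|psum s k.+1| <= M ^+ k.+1) ->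
  {in s, forall x, `|x| <= M *+ 2}.
Proof.
move=> M0 pM x xs; set n := size s in pM *; set r := `|x|.
have bM := newton_norm_le _ _ M n (coef0_revprod s) pM
  (fun k _ => newton_revprod s k).
pose S := \sum_(i < n) M ^+ (n.-1 - i) * r ^+ i.
(* Isolate the leading term of the equation with root [x]; the coefficient of index i is at most
   M^(n - i) in norm. *)
have rS : r ^+ n <= M * S.
  have : root (\prod_(y <- s) ('X - y%:P)) x by rewrite root_prod_XsubC.
  move/rootP; rewrite (@horner_coef_wide _ n.+1) ?size_prod_XsubC//.
  rewrite big_ord_recr /= (coef_prod_XsubC s n 0) ?addn0// coef0_revprod mul1r.
  move/eqP; rewrite addrC addr_eq0 => /eqP xn.
  rewrite /r -normrX xn normrN (le_trans (ler_norm_sum _ _ _))// mulr_sumr.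
  apply: ler_sum => i _; rewrite normrM normrX mulrA -exprS.
  rewrite ler_wpM2r ?exprn_ge0 ?normr_ge0//.
  rewrite (coef_prod_XsubC s i (n - i)) ?subnKC ?(ltnW (ltn_ord i))//.
  have -> : (n.-1 - i).+1 = (n - i)%N by case: (n) i => [[]//|m] i; rewrite subSn// -ltnS.
  by rewrite bM// leq_subr.
have r0 : 0 <= r by apply: normr_ge0.
(* If r > 2 M, then (r - M) S = r^n - M^n turns [rS] into (r - 2 M) r^n <= - M^(n+1) <= 0, a
   contradiction. *)
have [//|rM] := real_leP (ger0_real r0) (ger0_real (mulrn_wge0 2 M0)).
have Mr : M < r by rewrite (le_lt_trans _ rM)// mulr2n lerDl.
have := subrXX M r n; rewrite -/S => E.
have rMn : (r - M) * r ^+ n <= M * (r ^+ n - M ^+ n).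
  have -> : r ^+ n - M ^+ n = (r - M) * S by rewrite -[LHS]opprB E -mulNr opprB.
  by rewrite mulrCA ler_wpM2l// subr_ge0 ltW.
have : 0 < (r - M *+ 2) * r ^+ n.
  by rewrite mulr_gt0 ?exprn_gt0 ?subr_gt0// (le_lt_trans M0).
have -> : (r - M *+ 2) * r ^+ n =
    (r - M) * r ^+ n - M * (r ^+ n - M ^+ n) - M * M ^+ n by ring.
rewrite subr_gt0 => /lt_le_trans/(_ (_ : _ <= 0)); rewrite subr_le0 => /(_ rMn).
by rewrite le_gtF// mulr_ge0 ?exprn_ge0.
Qed.

(** With u = |x + y| and v = |x - y|, 4 |x|^2 <= (u + v)^2 <= 2 u^2 + 2 v^2 <= 2 M^2 + 6 M^2. *)
Lemma norm_pair_le {F : numClosedFieldType} {x y M : F} :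
  0 <= M -> `|x + y| <= M -> `|x ^+ 2 + y ^+ 2| <= M ^+ 2 ->
  `|x| ^+ 2 <= M ^+ 2 *+ 2.
Proof.
move=> M0 s1 s2.
have s1' : `|x + y| ^+ 2 <= M ^+ 2 by rewrite lerXn2r ?nnegrE ?normr_ge0.
have d2 : `|x - y| ^+ 2 <= M ^+ 2 *+ 3.
  rewrite -normrX (_ : (x - y) ^+ 2 = (x ^+ 2 + y ^+ 2) *+ 2 - (x + y) ^+ 2); last by ring.
  rewrite (le_trans (ler_normB _ _))// normrMn normrX [leRHS]mulrSr.
  by rewrite lerD// lerMn2r.
have t : `|x *+ 2| <= `|x + y| + `|x - y|.
  by rewrite (_ : x *+ 2 = (x + y) + (x - y)) ?ler_normD//; ring.
have t2 : `|x *+ 2| ^+ 2 <= (`|x + y| + `|x - y|) ^+ 2.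
  by rewrite lerXn2r ?nnegrE ?addr_ge0 ?normr_ge0.
have q : 0 <= (`|x + y| - `|x - y|) ^+ 2.
  by rewrite real_exprn_even_ge0// rpredB ?normr_real.
rewrite -(@ler_pMn2r _ 4)//.
have -> : `|x| ^+ 2 *+ 4 = `|x *+ 2| ^+ 2 by rewrite normrMn; ring.
rewrite (le_trans t2)// -[leLHS]addr0 (le_trans (lerD (lexx _) q))//.
rewrite (_ : _ + _ = `|x + y| ^+ 2 *+ 2 + `|x - y| ^+ 2 *+ 2); last by ring.
rewrite -[leRHS](_ : M ^+ 2 *+ 2 + M ^+ 2 *+ 3 *+ 2 = _); last by ring.
by rewrite lerD// lerMn2r.
Qed.

(** * Values of the sine constant *)

Lemma sin_pi4_sqr {R : realType} : sin (pi / 4) ^+ 2 = 2^-1 :> R.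
Proof.
have := cos_mulr2n (pi / 4 : R).
rewrite (_ : pi / 4 *+ 2 = pi / 2 :> R); last by field.
by rewrite cos_pihalf cos2sin2 => h; lra.
Qed.

Lemma sin_pi6 {R : realType} : sin (pi / 6) = 2^-1 :> R.
Proof.
have p0 := pi_gt0 R.
have s0 : 0 < sin (pi / 6 : R).
  by apply: sin_gt0_pihalf; apply/andP; split; lra.
(* With s = sin (pi / 6), both s and 1 - 2 s^2 equal cos (pi / 3); the only positive solution is
   1/2. *)
have := cosBpihalf (pi / 6 : R).
rewrite (_ : pi / 6 - pi / 2 = - (pi / 6 *+ 2) :> R); last by field.
rewrite cosN cos_mulr2n cos2sin2; move: s0; set s := sin _ => s0 h.
have /eqP : (s + 1) * (s - 2^-1) = 0 by lra.
by rewrite mulf_eq0 => /orP[] /eqP; lra.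
Qed.

Lemma le_sin_const2 {R : realType} (n : nat) : (3 <= n)%N -> 2 <= sin_const R n.
Proof.
move=> n3; have p0 := pi_gt0 R.
have nR : (6 : R) <= (2 * n)%:R by rewrite (ler_nat R 6) (leq_mul2l 2 3 n).
have n0 : (0 : R) < (2 * n)%:R by rewrite (lt_le_trans _ nR).
have x0 : 0 < pi / (2 * n)%:R :> R by rewrite divr_gt0.
have x6 : pi / (2 * n)%:R <= pi / 6 :> R by rewrite ler_pM2l// lef_pV2 ?posrE.
rewrite /sin_const -[leLHS]invrK lef_pV2 ?posrE ?invr_gt0//; last first.
  by apply: sin_gt0_pihalf; apply/andP; split; lra.
by rewrite -sin_pi6 leNgt ltr_sin -?leNgt// in_itv /=; apply/andP; split; lra.
Qed.

(** * Coefficients of the power mean *)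

Lemma coef_exp_XsubC {F : comNzRingType} (c : F) (n j : nat) :
  (j <= n)%N -> (('X - c%:P) ^+ n)`_(n - j) = (- c) ^+ j *+ 'C(n, j).
Proof.
move=> jn; rewrite -polyCN exprDn coef_sum (bigD1 (inord j)) //= inordK ?ltnS//.
rewrite big1 ?addr0 => [|k kj].
  by rewrite coefMn -rmorphXn coefMC coefXn eqxx mul1r.
rewrite coefMn -rmorphXn coefMC coefXn (_ : (_ == _) = false) ?mul0r ?mul0rn//.
apply: contra_neqF kj => /eqP e; apply: val_inj; rewrite /= inordK ?ltnS//.
by rewrite -(subKn jn) e subKn// -ltnS.
Qed.

Lemma coef_power_mean {R : realType} (n : nat) (z : n.-tuple R[i]) (j : nat) :
  (j <= n)%N ->
  (power_mean z)`_(n - j) = (-1) ^+ j * 'C(n, j)%:R * psum z j / n%:R.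
Proof.
move=> jn; rewrite /power_mean coefZ coef_sum mulrC; congr (_ / _).
rewrite /psum big_tuple mulr_sumr; apply: eq_bigr => i _.
by rewrite coef_exp_XsubC// [in LHS]exprNn -mulr_natr mulrAC.
Qed.

(** For 1 <= j <= n the coefficients of index n - j amount to the j-th power sum; those of index n
    are both 1, and higher ones vanish. *)
Lemma power_mean_eqP {R : realType} (n : nat) (f : {poly R[i]})
    (z : n.-tuple R[i]) :
  (0 < n)%N -> f \is monic -> size f = n.+1 ->
  f = power_mean z <->
  (forall k, (k < n)%N -> psum z k.+1 = (-1) ^+ k.+1 * ncoef n f k.+1).
Proof.
move=> n0 fm fs.
have nU : n%:R != 0 :> R[i] by rewrite pnatr_eq0 -lt0n.
have bU j : (j <= n)%N -> 'C(n, j)%:R != 0 :> R[i].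
  by move=> jn; rewrite pnatr_eq0 -lt0n bin_gt0.
have sgn j : (-1) ^+ j * (-1) ^+ j = 1 :> R[i] by rewrite -expr2 sqrr_sign.
split=> [fz k kn|pz].
  rewrite /ncoef {1}fz coef_power_mean//.
  have b0 := bU _ kn; set S := psum _ _; set b := 'C(_, _)%:R in b0 *.
  (* Inserting the square of the sign, which is 1, lets [field] treat the sign as an unknown [e]. *)
  rewrite -[LHS]mul1r -[X in X * _](sgn k.+1); set e := _ ^+ _; field.
  by rewrite nU b0.
have f1 : f`_n = 1 by have /monicP := fm; rewrite lead_coefE fs.
apply/polyP => i; have [ilen|ni] := leqP i n; last first.
  rewrite !nth_default ?fs//; apply: leq_trans ni.
  rewrite (leq_trans (size_scale_leq _ _))//.
  apply: (leq_trans (size_sum _ _ _)); apply/bigmax_leqP => j _.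
  by rewrite size_exp_XsubC.
rewrite -(subKn ilen); case: (n - i)%N (leq_subr i n) => [_|k kn].
  rewrite coef_power_mean// subn0 f1 expr0 bin0 /psum.
  rewrite (eq_bigr (fun=> 1)) => [|? _]; last by rewrite expr0.
  by rewrite big_const_seq count_predT iter_addr_0 size_tuple !mul1r divff.
have b0 := bU _ kn.
rewrite coef_power_mean// pz// /ncoef.
set b := 'C(_, _)%:R in b0 *; set a := f`_ _.
rewrite -[LHS]mul1r -[X in X * _](sgn k.+1); set e := _ ^+ _; field.
by rewrite nU b0.
Qed.

(** * The bound for complex points, with real-valued moduli *)

Lemma normc_ncoef_le {R : realType} (n : nat) (f : {poly R[i]}) (k : nat) :
  (k < n)%N -> Normc.normc (ncoef n f k.+1) <= coef_bound n f ^+ k.+1.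
Proof.
move=> kn; set c := Normc.normc _.
have c0 : 0 <= c by rewrite /c; case: (ncoef _ _ _) => *; apply: sqrtr_ge0.
have h : c `^ (k.+1%:R^-1) <= coef_bound n f.
  rewrite /coef_bound (bigD1_seq k.+1) ?iota_uniq ?mem_index_iota//=.
  by rewrite le_max lexx.
have -> : c = (c `^ (k.+1%:R^-1)) ^+ k.+1.
  by rewrite -powR_mulrn ?powR_ge0// -powRrM mulVf ?pnatr_eq0// powRr1.
by rewrite lerXn2r ?nnegrE ?powR_ge0// (le_trans (powR_ge0 _ _) h).
Qed.

Lemma norm_normc {R : rcfType} (x : R[i]) : `|x| = (Normc.normc x)%:C%C.
Proof. by case: x. Qed.

Lemma normc_psum_bound {R : realType} (s : seq R[i]) (M : R) :
  (0 < size s)%N -> 0 <= M ->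
  (forall k, (k < size s)%N -> Normc.normc (psum s k.+1) <= M ^+ k.+1) ->
  {in s, forall x, Normc.normc x <= sin_const R (size s) * M}.
Proof.
move=> s0 M0 pM x xs.
have pMC k : (k < size s)%N -> `|psum s k.+1| <= M%:C%C ^+ k.+1.
  by move=> ks; rewrite norm_normc -rmorphXn lecR pM.
have M0C : 0 <= M%:C%C by rewrite ler0c.
have [s3|] := leqP 3 (size s).
  have := norm_root_le s M%:C%C M0C pMC x xs.
  rewrite norm_normc -rmorphMn lecR => /le_trans; apply.
  by rewrite -mulr_natl ler_wpM2r// le_sin_const2.
(* A single point is its own first power sum, and sin (pi / 2) = 1. *)
case: s s0 pM xs pMC => [//|a [|b [|//]]] _ pM xs pMC _ /=.
  move: xs (pM 0 isT); rewrite inE => /eqP ->.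
  by rewrite /psum big_seq1 expr1 /sin_const muln1 sin_pihalf invr1 mul1r.
(* For two points, compare squares: sin (pi / 4)^2 = 1/2 matches the factor 2 of [norm_pair_le]. *)
rewrite /sin_const mulrC ler_pdivlMr; last first.
  by apply: sin_gt0_pihalf; have := pi_gt0 R => p0; apply/andP; split; lra.
have x2 : Normc.normc x ^+ 2 <= M ^+ 2 *+ 2.
  rewrite -lecR rmorphXn rmorphMn rmorphXn /= -norm_normc.
  have := pMC 0 isT; have := pMC 1 isT.
  rewrite /psum !big_cons !big_nil !addr0 !expr1 => h2 h1.
  move: xs; rewrite !inE => /orP[] /eqP ->; first exact: norm_pair_le M0C h1 h2.
  by rewrite addrC in h1; rewrite addrC in h2; exact: norm_pair_le M0C h1 h2.
have N0 : 0 <= Normc.normc x by case: (x) => *; apply: sqrtr_ge0.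
have sn0 : 0 <= sin (pi / 4 : R).
  by apply: sin_ge0_pi; have := pi_gt0 R => p0; apply/andP; split; lra.
rewrite -(@ler_pXn2r _ 2) ?nnegrE ?mulr_ge0// exprMn sin_pi4_sqr.
by rewrite ler_pdivrMr// mulr_natr.
Qed.

Theorem theorem3 (R : realType) (n : nat) (hn : (1 <= n)%N)
    (f : {poly R[i]}) (fmonic : f \is monic) (fdeg : size f = n.+1) :
  exists z : n.-tuple R[i],
    [/\ f = power_mean z,
        forall w : n.-tuple R[i], f = power_mean w -> perm_eq w z
      & forall i : 'I_n,
          Normc.normc (tnth z i) <= sin_const R n * coef_bound n f].
Proof.
(* Prescribe the power sums to which [power_mean_eqP] reduces the equation. *)
have [s ss ps] := psum_exists (fun k => (-1) ^+ k * ncoef n f k) n.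
have zP : size s == n by apply/eqP.
pose z := Tuple zP; exists z.
have fP w := power_mean_eqP n f w hn fmonic fdeg.
split=> [|w /fP pw|i]; first exact/fP.
  by apply: perm_eq_psum => [|k]; rewrite size_tuple ?ss// => kn; rewrite pw// ps.
have M0 : 0 <= coef_bound n f.
  rewrite /coef_bound; elim/big_ind: _ => // [a b a0 b0|k _].
    by rewrite le_max a0.
  exact: powR_ge0.
rewrite -[in sin_const _ _]ss; apply: normc_psum_bound; rewrite ?ss ?mem_tnth//.
move=> k kn; rewrite ps// Normc.normcM.
have -> : Normc.normc ((-1) ^+ k.+1 : R[i]) = 1.
  by apply: complexI; rewrite -norm_normc normrX normrN1 expr1n.
by rewrite mul1r normc_ncoef_le.
Qed.
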